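(* Let $A,B$ be complex $d\times d$ matrices, let $m,n,s,t$ be real numbers such that $m+n=s+t=1$, and let $|||\cdot|||$ be an arbitrary unitarily invariant norm on the $d\times d$ complex matrices. Then $$|||AB^*|||^2\leq \left|\left|\left|p(A^*A)^{\frac{m}{p}}+ (1-p)(B^*B)^{\frac{s}{1-p}}\right|\right|\right|\;\left|\left|\left|(1-p)(A^*A)^{\frac{n}{1-p}}+ p(B^*B)^{\frac{t}{p}}\right|\right|\right|,$$ where $p\in[0,1]$.
   Context: A norm $|||\cdot|||$ on the $d\times d$ complex matrices is unitarily invariant if $|||UAV|||=|||A|||$ for all matrices $A$ and all unitary matrices $U,V$. Powers of the positive semidefinite matrices $A^*A$ and $B^*B$ are understood in the sense of the functional calculus for Hermitian matrices.
   Formalization: At p=0 or p=1 the exponents m/p, t/p, s/(1-p), n/(1-p) are undefined; there each such term is read as the limit as the weight tends to 0 from above, assumed to exist at all eigenvalues. Negative powers of singular matrices are taken as powers of the pseudo-inverse. *)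

(* Defs.v *)
From HB Require Import structures.
From mathcomp Require Import all_boot all_order all_algebra.
From mathcomp Require Import complex.
From mathcomp Require Import all_classical all_reals all_analysis.

Set Implicit Arguments.
Unset Strict Implicit.
Unset Printing Implicit Defensive.

Import Order.TTheory GRing.Theory Num.Theory.
Import numFieldNormedType.Exports.

Local Open Scope classical_set_scope.
Local Open Scope ring_scope.
Local Open Scope complex_scope.
Local Open Scope sesquilinear_scope.

Section MatrixNorms.
Variables (R : realType) (d : nat).

Definition is_matrix_norm (N : 'M[R[i]]_d -> R) : Prop :=
  [/\ forall A, N A = 0 -> A = 0,
      forall (c : R[i]) A, N (c *: A) = Normc.normc c * N A
    & forall A B, N (A + B) <= N A + N B].

Definition is_unitarily_invariant_norm (N : 'M[R[i]]_d -> R) : Prop :=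
  is_matrix_norm N /\
  forall A U V : 'M[R[i]]_d, U \is unitarymx -> V \is unitarymx ->
    N (U *m A *m V) = N A.

End MatrixNorms.

Section FunctionalCalculus.
Variables (R : realType) (d : nat).
Implicit Types (H X : 'M[R[i]]_d) (f : R -> R) (r w : R).

(* Meant for Hermitian H, whose spectral_diag is real, so that taking the real
   part loses nothing. *)
Definition eigval H (k : 'I_d) : R := complex.Re (spectral_diag H 0 k).

Definition hermfun f H : 'M[R[i]]_d :=
  invmx (spectralmx H) *m diag_mx (\row_k (f (eigval H k))%:C)
    *m spectralmx H.

(* Meant for positive semidefinite X. The conventions of powR apply to the
   eigenvalue 0: 0 `^ 0 = 1 (so mxpow X 0 = 1%:M), and 0 `^ r = 0 when r != 0;
   for r < 0 and singular X this is the power of the pseudo-inverse. *)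
Definition mxpow X r : 'M[R[i]]_d := hermfun (fun x => x `^ r) X.

(* The term w X^(r/w). For w = 0 the exponent r/w is meaningless, and the term
   is obtained by applying to X the pointwise limit of the scalar functions
   x |-> q x^(r/q) as q tends to 0 from above. *)
Definition weighted_pow w r X : 'M[R[i]]_d :=
  if w == 0 then hermfun (fun x => lim (q * x `^ (r / q) @[q --> 0^'+])) X
  else w%:C *: mxpow X (r / w).

(* No condition when w != 0. For w = 0, the limit above must exist (in R) at
   every eigenvalue of X; otherwise q x^(r/q) tends to +oo at some of them. *)
Definition weighted_pow_defined w r X : Prop :=
  w = 0 -> forall k, cvg (q * eigval X k `^ (r / q) @[q --> 0^'+]).

End FunctionalCalculus.

(* Main.v *)
(* Diagonalising A^*A and B^*B with eigenvalues x and y reduces the left-hand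
   side to N (diag(sqrt x) W diag(sqrt y))^2, with W unitary. Since
   x = x^m x^n and y = y^s y^t, a Cauchy-Schwarz inequality bounds it by
     N (diag(x^m) W diag(y^s)) * N (diag(x^n) W diag(y^t)),
   and each factor is estimated by Ando's matrix Young inequality. Both
   inequalities are obtained without majorization theory: N decreases when a
   matrix is replaced by its diagonal part in any pair of orthonormal bases
   (pinching) and when it is multiplied by a diagonal contraction, so it
   suffices to exhibit, by Gram-Schmidt, bases in which the diagonal entries
   dominate the singular values. Zero eigenvalues are reached by perturbation. *)
Require Import Defs.
From HB Require Import structures.
From mathcomp Require Import all_boot all_order all_algebra all_fingroup.
From mathcomp Require Import complex.
From mathcomp Require Import all_classical all_reals all_analysis.
From mathcomp Require Import ring lra.
Import Order.TTheory GRing.Theory Num.Theory.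
Import numFieldNormedType.Exports.
Local Open Scope classical_set_scope.
Local Open Scope ring_scope.
Local Open Scope complex_scope.
Local Open Scope sesquilinear_scope.

(** * Adjoints, unitary matrices and real diagonal matrices *)

Section Matrices.
Context {R : realType} {d : nat}.
Implicit Types (A B L M U V : 'M[R[i]]_d) (r s c : 'I_d -> R).

Lemma adjM A B : (A *m B)^t* = B^t* *m A^t*.
Proof. by rewrite trmx_mul map_mxM. Qed.

Lemma mulUadj U : U \is unitarymx -> U *m U^t* = 1%:M.
Proof. by move/unitarymxP. Qed.

Lemma muladjU U : U \is unitarymx -> U^t* *m U = 1%:M.
Proof. by move=> uU; rewrite -invmx_unitary ?mulVmx ?unitarymx_unit. Qed.

Lemma unitarymx1 : (1%:M : 'M[R[i]]_d) \is unitarymx.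
Proof. by apply/unitarymxP; rewrite trmx1 map_mx1 mulmx1. Qed.

Lemma adj_unitarymx U : U \is unitarymx -> U^t* \is unitarymx.
Proof. by rewrite trmxC_unitary. Qed.

Definition dgmx r : 'M[R[i]]_d := diag_mx (\row_k (r k)%:C).

Lemma dgmxE r j k : dgmx r j k = (r j)%:C *+ (j == k).
Proof. by rewrite !mxE; case: eqP => [->|]. Qed.

Lemma eq_dgmx r s : r =1 s -> dgmx r = dgmx s.
Proof. by move=> rs; apply/matrixP => j k; rewrite !dgmxE rs. Qed.

Lemma dgmxM r s : dgmx r *m dgmx s = dgmx (fun k => r k * s k).
Proof.
rewrite /dgmx mulmx_diag; congr diag_mx; apply/rowP => k.
by rewrite !mxE rmorphM.
Qed.

Lemma dgmxD r s : dgmx r + dgmx s = dgmx (fun k => r k + s k).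
Proof.
rewrite /dgmx -linearD; congr diag_mx; apply/rowP => k.
by rewrite !mxE rmorphD.
Qed.

Lemma dgmxZ (x : R) r : x%:C *: dgmx r = dgmx (fun k => x * r k).
Proof.
by apply/matrixP => j k; rewrite mxE !dgmxE rmorphM mulrnAr.
Qed.

Lemma dgmx1 : dgmx (fun=> 1) = 1%:M.
Proof. by apply/matrixP => j k; rewrite dgmxE mxE. Qed.

Lemma dgmx_adj r : (dgmx r)^t* = dgmx r.
Proof.
rewrite /dgmx tr_diag_mx map_diag_mx; congr diag_mx; apply/rowP => k.
by rewrite !mxE; apply/eqP; rewrite eq_complex /= oppr0 !eqxx.
Qed.

Lemma mul_dgmxE r A j k : (dgmx r *m A) j k = (r j)%:C * A j k.
Proof. by rewrite mul_diag_mx !mxE. Qed.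

Lemma mulmx_dgE r A j k : (A *m dgmx r) j k = A j k * (r k)%:C.
Proof. by rewrite mul_mx_diag !mxE. Qed.

Lemma diag_unitarymx (u : 'rV[R[i]]_d) :
  (forall k, u 0 k * (u 0 k)^* = 1) -> diag_mx u \is unitarymx.
Proof.
move=> hu; apply/unitarymxP; rewrite tr_diag_mx map_diag_mx mulmx_diag.
by apply/matrixP => j k; rewrite !mxE hu.
Qed.

End Matrices.

(** * Monotonicity and pinching for unitarily invariant norms *)

Section Norm.
Context {R : realType} {d : nat} {N : 'M[R[i]]_d -> R}.
Hypothesis Nui : is_unitarily_invariant_norm N.
Implicit Types (A B L M U V : 'M[R[i]]_d) (r s c : 'I_d -> R).

Lemma uinormZ (x : R) A : 0 <= x -> N (x%:C *: A) = x * N A.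
Proof.
move=> x0; case: Nui => -[_ -> _] _; congr (_ * _).
by rewrite /Normc.normc /= expr0n /= addr0 sqrtr_sqr ger0_norm.
Qed.

Lemma uinormD A B : N (A + B) <= N A + N B.
Proof. by case: Nui => -[]. Qed.

Lemma uinorm0 : N 0 = 0.
Proof. by rewrite -(scale0r 0) (uinormZ 0) ?mul0r. Qed.

Lemma uinormU U V A : U \is unitarymx -> V \is unitarymx ->
  N (U *m A *m V) = N A.
Proof. by case: Nui => _; apply. Qed.

Lemma uinormUl U A : U \is unitarymx -> N (U *m A) = N A.
Proof. by move=> uU; rewrite -[U *m A]mulmx1 uinormU ?unitarymx1. Qed.

Lemma uinormUr U A : U \is unitarymx -> N (A *m U) = N A.
Proof. by move=> uU; rewrite -[in LHS](mul1mx A) uinormU ?unitarymx1. Qed.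

Lemma uinorm_ge0 A : 0 <= N A.
Proof.
have : N (A - A) <= N A + N (- A) by exact: uinormD.
rewrite subrr uinorm0; suff -> : N (- A) = N A by lra.
rewrite -[- A]mul1mx mulmxN -mulNmx uinormUl //; apply/unitarymxP.
by rewrite linearN /= map_mxN trmx1 map_mx1 mulmxN mulNmx opprK mulmx1.
Qed.

Lemma uinorm_avg A B : N A = N B -> N (2^-1%:C *: (A + B)) <= N B.
Proof.
move=> AB; rewrite uinormZ ?invr_ge0 ?ler0n//.
by have := uinormD A B; rewrite AB; lra.
Qed.

(* A diagonal contraction is the average of the unitary [c + i sqrt (1 - c^2)]
   and of its adjoint. *)
Lemma uinorm_contract c A : (forall k, 0 <= c k <= 1) ->
  N (dgmx c *m A) <= N A.
Proof.
move=> c01.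
pose D (e : R) : 'M[R[i]]_d :=
  diag_mx (\row_k (c k +i* (e * Num.sqrt (1 - c k ^+ 2)))%C).
have Du e : e ^+ 2 = 1 -> D e \is unitarymx.
  move=> e1; apply: diag_unitarymx => k; rewrite mxE.
  apply/eqP; rewrite eq_complex /= ; apply/andP; split; apply/eqP; last by ring.
  have: Num.sqrt (1 - c k ^+ 2) ^+ 2 = 1 - c k ^+ 2.
    by rewrite sqr_sqrtr // subr_ge0 expr_le1 //; case/andP: (c01 k).
  set q := Num.sqrt _; move=> hq.
  have -> : c k * c k - e * q * - (e * q) = c k ^+ 2 + e ^+ 2 * q ^+ 2 by ring.
  by rewrite e1 hq; ring.
have -> : dgmx c *m A = 2^-1%:C *: (D 1 *m A + D (-1) *m A).
  rewrite -mulmxDl scalemxAl; congr (_ *m _).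
  apply/matrixP => j k; rewrite !mxE; case: eqP => _; last first.
    by rewrite !mulr0n addr0 mulr0.
  rewrite !mulr1n; apply/eqP; rewrite eq_complex /=.
  by apply/andP; split; apply/eqP; field.
have u1 : D 1 \is unitarymx by apply: Du; ring.
have u2 : D (-1) \is unitarymx by apply: Du; ring.
by rewrite -[leRHS](uinormUl _ A u2) uinorm_avg // !uinormUl.
Qed.

Lemma uinorm_dgmxl_le r s A : (forall k, 0 <= r k <= s k) ->
  N (dgmx r *m A) <= N (dgmx s *m A).
Proof.
move=> rs; have -> : dgmx r = dgmx (fun k => r k / s k) *m dgmx s.
  rewrite dgmxM; apply: eq_dgmx => k.
  have /andP[r0 rs'] := rs k.
  (* Where [s k = 0] also [r k = 0], so the convention that division by 0 gives 0 is harmless. *)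
  have [s0|s0] := eqVneq (s k) 0; last by rewrite divfK.
  by apply/le_anti; rewrite s0 mulr0 r0 andbT -s0.
rewrite -mulmxA uinorm_contract // => k; have /andP[r0 rs'] := rs k.
have s0 := le_trans r0 rs'; rewrite divr_ge0 //=.
have [->|s1] := eqVneq (s k) 0; first by rewrite invr0 mulr0.
by rewrite ler_pdivrMr ?mul1r // lt_def s1.
Qed.

Lemma uinorm_dgmx_le r s : (forall k, 0 <= r k <= s k) ->
  N (dgmx r) <= N (dgmx s).
Proof. by move=> /(uinorm_dgmxl_le _ _ 1%:M); rewrite !mulmx1. Qed.

(* Off-diagonal entries are removed one row and column at a time, by averaging
   the matrix with its conjugate by a reflection [1 - 2 e_i e_i^*]. *)
Lemma uinorm_pinch A : N (diag_mx (\row_k A k k)) <= N A.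
Proof.
pose pin (l : seq 'I_d) : 'M[R[i]]_d := \matrix_(j, k)
  if (j != k) && ((j \in l) || (k \in l)) then 0 else A j k.
suff H l : N (pin l) <= N A.
  suff -> : diag_mx (\row_k A k k) = pin (enum 'I_d) by exact: H.
  apply/matrixP => j k; rewrite !mxE !mem_enum.
  by case: eqP => [->|].
elim: l => [|i l IH].
  suff -> : pin [::] = A by [].
  by apply/matrixP => j k; rewrite mxE !in_nil andbF.
apply: le_trans IH.
pose D : 'M[R[i]]_d := diag_mx (\row_k (-1) ^+ (k == i)).
have uD : D \is unitarymx.
  apply: diag_unitarymx => k; rewrite mxE rmorphXn rmorphN rmorph1.
  by case: eqP => _; rewrite /= ?expr0 ?expr1 ?mulrNN mul1r.
have -> : pin (i :: l) = 2^-1%:C *: (D *m pin l *m D + pin l).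
  apply/matrixP => j k.
  rewrite /D mul_mx_diag mul_diag_mx /pin !mxE !in_cons.
  have h2 (z : R[i]) : 2^-1%:C * (z + z) = z.
    by case: z => x y; apply/eqP; rewrite eq_complex /=; apply/andP; split;
      apply/eqP; field.
  have [->|jk] /= := eqVneq j k.
    case: (k == i); rewrite /= ?expr0 ?expr1 ?mulN1r ?mulrN1 ?opprK.
      by rewrite h2.
    by rewrite mul1r mulr1 h2.
  case jl: ((j \in l) || (k \in l)).
    have -> : ((j == i) || (j \in l)) || ((k == i) || (k \in l)).
      by case/orP: jl => ->; rewrite ?orbT.
    by rewrite mulr0 mul0r addr0 mulr0.
  move/negbT: jl; rewrite negb_or => /andP[/negPf -> /negPf ->].
  rewrite !orbF; have [ji|ji] := eqVneq j i; have [ki|ki] := eqVneq k i => /=.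
  - by rewrite ji ki eqxx in jk.
  - by rewrite expr1 expr0 mulr1 mulN1r addNr mulr0.
  - by rewrite expr1 expr0 mulrN1 mul1r addNr mulr0.
  - by rewrite expr0 mul1r mulr1 h2.
by rewrite uinorm_avg // uinormU.
Qed.

(** A diagonal unitary of phases turns the diagonal entries into their moduli; pinching and
    monotonicity then conclude. *)
Lemma uinorm_diag_ge r (z : 'I_d -> R[i]) A :
  (forall k, A k k = z k) -> (forall k, 0 <= r k) ->
  (forall k, (r k)%:C <= `|z k|) -> N (dgmx r) <= N A.
Proof.
move=> Az r0 rz.
pose u : 'rV[R[i]]_d := \row_k (if z k == 0 then 1 else `|z k| / z k).
have uu : diag_mx u \is unitarymx.
  apply: diag_unitarymx => k; rewrite -normCK mxE; case: eqP => [|/eqP] zk.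
    by rewrite normr1 expr1n.
  by rewrite normrM normfV normr_id divff ?normr_eq0// expr1n.
rewrite -(uinormUl _ A uu).
apply: le_trans (uinorm_pinch _).
have -> : diag_mx (\row_k (diag_mx u *m A) k k) = dgmx (fun k => complex.Re `|z k|).
  rewrite /dgmx; congr diag_mx; apply/rowP => k.
  rewrite [LHS]mxE [RHS]mxE mul_diag_mx !mxE Az.
  have -> : (complex.Re `|z k|)%:C = `|z k| by rewrite normc_def.
  case: eqP => [->|/eqP zk]; first by rewrite normr0 mulr0.
  by rewrite divfK.
apply: uinorm_dgmx_le => k; rewrite r0 /=.
by have := rz k; rewrite lecE => /andP[].
Qed.

End Norm.

(** * Triangular, polar and singular value factorizations *)

Section Factorizations.
Context {R : realType} {d : nat}.
Implicit Types (A B G L M U V : 'M[R[i]]_d) (r s x : 'I_d -> R).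

Lemma mulmx_adjE (p q l : nat) (A : 'M[R[i]]_(p, q)) (B : 'M[R[i]]_(l, q)) j k :
  (A *m B^t*) j k = \sum_h A j h * (B k h)^*.
Proof. by rewrite mxE; apply: eq_bigr => h _; rewrite !mxE. Qed.

(** Gram-Schmidt on the rows: row i of [A] lies in the span of the first i orthonormal rows (counted
    from 1), hence is orthogonal to the later ones. *)
Lemma lower_unitary_factor A : exists L B,
  [/\ B \is unitarymx, is_trig_mx L, A = L *m B & forall k, 0 <= L k k].
Proof.
have uB : schmidt A \is unitarymx by exact: schmidt_unitarymx.
exists (A *m (schmidt A)^t*), (schmidt A); split => //.
- apply/is_trig_mxP => i j ij.
  have -> : (A *m (schmidt A)^t*) i j =
      (row i A *m (row j (schmidt A))^t*) 0 0.
    by rewrite !mulmx_adjE; apply: eq_bigr => l _; rewrite !mxE.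
  suff /sub_kermxP -> : (row i A <= kermx ((row j (schmidt A))^t*))%MS.
    by rewrite mxE.
  apply: submx_trans (row_schmidt_sub _ _) _; apply/sumsmx_subP => k ki.
  rewrite genmxE; apply/sub_kermxP/matrixP => a b; rewrite !ord1.
  have /matrixP/(_ k j) := mulUadj _ uB; rewrite !mulmx_adjE !mxE.
  have /negPf -> : k != j by apply: contraTneq ki => ->; rewrite -ltnNge.
  by move=> H; rewrite -[RHS]H; apply: eq_bigr => l _; rewrite !mxE.
- by rewrite -mulmxA muladjU ?mulmx1.
- move=> k; have := form1_row_schmidt A k; rewrite dotmxE.
  by rewrite !mulmx_adjE; under eq_bigr do rewrite !mxE.
Qed.

(** In [G = L *m B] the lower triangular [L] also has orthogonal rows and a nonnegative diagonal,
    which forces it to be diagonal, row after row. The decreasing order puts the zero rows last, so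
    that no zero pivot precedes a nonzero row. *)
Lemma orthogonal_rows_sorted G x : G *m G^t* = dgmx x ->
  (forall k, 0 <= x k) -> (forall j k : 'I_d, (j <= k)%N -> x k <= x j) ->
  exists2 B, B \is unitarymx & G = dgmx (fun k => Num.sqrt (x k)) *m B.
Proof.
move=> Gx x0 xle; have [L [B [uB trL GL L0]]] := lower_unitary_factor G.
exists B => //; rewrite GL; congr (_ *m _).
have {}Gx : L *m L^t* = dgmx x.
  by rewrite -Gx GL adjM mulmxA -(mulmxA L) (mulUadj B) // mulmx1.
have LE j k : \sum_l L j l * (L k l)^* = (x j)%:C *+ (j == k).
  by rewrite -mulmx_adjE Gx dgmxE.
apply/matrixP => j; have [n] := ubnP j; elim: n j => // n IH j jn k.
rewrite dgmxE; have [xj0|xj0] := eqVneq (x j) 0.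
  rewrite xj0 sqrtr0 mul0rn; have := LE j j; rewrite xj0 mul0rn.
  move=> /psumr_eq0P/(_ k isT) => H; apply/eqP.
  rewrite -normr_eq0 -sqrf_eq0 normCK H // => l _; exact: mul_conjC_ge0.
have Ljk l : (l != j)%N -> L j l = 0.
  rewrite neq_ltn => /orP[lj|jl]; last exact: (is_trig_mxP trL).
  have := LE j l; rewrite (bigD1 l) //= big1 ?addr0 => [|h hl]; last first.
    by rewrite (IH l) ?(leq_trans lj) // dgmxE eq_sym (negPf hl) rmorph0 mulr0.
  have /negPf -> : j != l by rewrite neq_ltn lj orbT.
  move/eqP; rewrite mulf_eq0 => /orP[/eqP //|]; rewrite conjC_eq0.
  rewrite (IH l) ?(leq_trans lj) // dgmxE eqxx eq_complex /= eqxx andbT sqrtr_eq0.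
  (* A zero pivot [L l l] would mean [x l = 0], hence [x j = 0] since [x j <= x l]. *)
  move/(le_trans (xle l j (ltnW lj))) => xj.
  by move: xj0; rewrite eq_le xj x0.
have [<-|jk] := eqVneq j k; last by rewrite Ljk // eq_sym.
have := LE j j; rewrite (bigD1 j) //= big1 ?addr0 => [|l lj]; last first.
  by rewrite Ljk // mul0r.
rewrite eqxx !mulr1n geC0_conj // => Ljj; apply/eqP.
rewrite -(eqrXn2 (n := 2)) ?L0 ?lecE /= ?eqxx ?sqrtr_ge0 // expr2 Ljj.
by rewrite -rmorphXn sqr_sqrtr.
Qed.

Lemma sorting_perm r : exists p : 'S_d,
  forall j k : 'I_d, (j <= k)%N -> r (p k) <= r (p j).
Proof.
pose t := [tuple r k | k < d].
have /tuple_permP[p tp] : perm_eq (sort >=%R t) t by rewrite perm_sort.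
exists p => j k jk.
have rE l : r (p l) = nth 0 (sort >=%R t) l.
  by rewrite tp nth_mktuple tnth_mktuple.
rewrite !rE; apply: (sorted_leq_nth (leT := >=%R)) => //.
- by move=> a b c /= ba ac; apply: le_trans ac ba.
- exact: lexx.
- by apply: sort_sorted => a b; exact: le_total.
- by rewrite inE size_sort size_tuple.
- by rewrite inE size_sort size_tuple.
Qed.

Lemma perm_unitarymx (p : 'S_d) : (perm_mx p : 'M[R[i]]_d) \is unitarymx.
Proof.
apply/unitarymxP.
by rewrite tr_perm_mx map_perm_mx -perm_mxM mulgV perm_mx1.
Qed.

Lemma orthogonal_rows G x : G *m G^t* = dgmx x -> (forall k, 0 <= x k) ->
  exists2 B, B \is unitarymx & G = dgmx (fun k => Num.sqrt (x k)) *m B.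
Proof.
move=> Gx x0; have [p xp] := sorting_perm x.
have [|||B uB GB] := orthogonal_rows_sorted (row_perm p G) (x \o p).
- apply/matrixP => j k; have /matrixP/(_ (p j) (p k)) := Gx.
  rewrite !mulmx_adjE !dgmxE (inj_eq perm_inj) => <-.
  by apply: eq_bigr => l _; rewrite !mxE.
- by move=> k; exact: x0.
- exact: xp.
exists (row_perm p^-1%g B).
  by rewrite row_permE mul_unitarymx ?perm_unitarymx.
apply/matrixP => j k; have /matrixP/(_ (p^-1%g j) k) := GB.
by rewrite !mul_dgmxE !mxE /= permKV.
Qed.

(** A polar decomposition, valid also for singular [A]. If P diagonalises X, the rows of P times the
    adjoint of [A] are orthogonal, with squared lengths the eigenvalues of X; normalising them gives
    the unitary factor. *)
Lemma gram_factor A (X := A^t* *m A) : (forall k, 0 <= eigval X k) /\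
  exists2 U, U \is unitarymx &
    A = U *m dgmx (fun k => Num.sqrt (eigval X k)) *m spectralmx X.
Proof.
set P := spectralmx X; have uP : P \is unitarymx by exact: spectral_unitarymx.
have hX : X^t* = X by rewrite adjM trmxCK.
have /orthomx_spectralP XE : X \is normalmx by apply/normalmxP; rewrite hX.
have GE : (P *m A^t*) *m (P *m A^t*)^t* = diag_mx (spectral_diag X).
  rewrite adjM trmxCK mulmxA -(mulmxA P) -/X {1}XE -/P invmx_unitary //.
  by rewrite !mulmxA mulUadj // mul1mx -mulmxA mulUadj // mulmx1.
have sp0 k : 0 <= spectral_diag X 0 k.
  have /matrixP/(_ k k) := GE; rewrite mulmx_adjE [RHS]mxE eqxx mulr1n => <-.
  by apply: sumr_ge0 => l _; exact: mul_conjC_ge0.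
have x0 k : 0 <= eigval X k by have := sp0 k; rewrite lecE => /andP[].
split=> //.
have spE : diag_mx (spectral_diag X) = dgmx (eigval X).
  congr diag_mx; apply/rowP => k; rewrite mxE /eigval RRe_real //.
  exact: ger0_real.
have [B uB PB] := orthogonal_rows _ _ (etrans GE spE) x0.
exists (B^t*); first by rewrite trmxC_unitary.
have : (P *m A^t*)^t* *m P = A.
  by rewrite adjM trmxCK -mulmxA muladjU // mulmx1.
by rewrite PB adjM dgmx_adj.
Qed.

Lemma singular_value_decomposition M : exists U V s,
  [/\ U \is unitarymx, V \is unitarymx, M = U *m dgmx s *m V,
      forall k, 0 <= s k & forall j k : 'I_d, (j <= k)%N -> s k <= s j].
Proof.
have [_ [U uU ME]] := gram_factor M; set P := spectralmx _ in ME.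
set s := (fun k => _) in ME.
have uP : P \is unitarymx by exact: spectral_unitarymx.
have [p sp] := sorting_perm s.
exists (U *m (perm_mx p)^t*), (perm_mx p *m P), (s \o p).
have uPp : perm_mx p \is unitarymx := perm_unitarymx p.
split.
- exact: mul_unitarymx uU (adj_unitarymx _ uPp).
- exact: mul_unitarymx uPp uP.
- have -> : U *m (perm_mx p)^t* *m dgmx (s \o p) *m (perm_mx p *m P) =
      U *m (perm_mx p)^t* *m (dgmx (s \o p) *m perm_mx p) *m P.
    by rewrite !mulmxA.
  suff -> : dgmx (s \o p) *m perm_mx p = perm_mx p *m dgmx s.
    by rewrite !mulmxA -(mulmxA U) muladjU ?perm_unitarymx // mulmx1.
  apply/matrixP => j k; rewrite mul_dgmxE -row_permE [in RHS]mxE dgmxE !mxE /=.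
  by rewrite mulr_natr.
- by move=> k; exact: sqrtr_ge0.
- exact: sp.
Qed.

Lemma trig_mul_diag A B s k : is_trig_mx A -> is_trig_mx B ->
  (A *m dgmx s *m B) k k = A k k * (s k)%:C * B k k.
Proof.
move=> /is_trig_mxP tA /is_trig_mxP tB.
rewrite mxE (bigD1 k) //= mulmx_dgE big1 ?addr0 // => l.
rewrite mulmx_dgE neq_ltn => /orP[lk|kl]; first by rewrite tB ?mulr0.
by rewrite tA ?mul0r.
Qed.

Lemma trig_inv A B : is_trig_mx A -> A *m B = 1%:M ->
  is_trig_mx B /\ forall k, A k k * B k k = 1.
Proof.
move=> trA AB; have tA := is_trig_mxP trA.
have Akk k : A k k != 0.
  have [uA _] := mulmx1_unit AB; move: uA.
  rewrite unitmxE det_trig // unitfE; apply: contraNneq => Akk.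
  by apply/eqP; rewrite (bigD1 k) //= Akk mul0r.
(* Forward substitution: once the earlier rows of [B] are known to vanish above the diagonal, entry
   (j, k) of [A *m B] reduces to [A j j * B j k]. *)
have tB (j k : 'I_d) : (j < k)%N -> B j k = 0.
  have [n] := ubnP j; elim: n j => // n IH j jn jk.
  have /matrixP/(_ j k) := AB.
  rewrite !mxE (bigD1 j) //= big1 ?addr0 => [|l]; last first.
    rewrite neq_ltn => /orP[lj|jl]; last by rewrite tA ?mul0r.
    by rewrite (IH l (leq_trans lj jn) (ltn_trans lj jk)) mulr0.
  have /negPf -> : j != k by rewrite neq_ltn jk.
  by move/eqP; rewrite mulf_eq0 (negPf (Akk j)) => /eqP.
have trB : is_trig_mx B by exact/is_trig_mxP.
split=> // k; have := trig_mul_diag A B (fun=> 1) k trA trB.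
by rewrite dgmx1 mulmx1 AB mxE eqxx rmorph1 mulr1 => <-.
Qed.

End Factorizations.

(** * A Cauchy-Schwarz inequality for unitarily invariant norms *)

Section CauchySchwarz.
Context {R : realType} {d : nat} {N : 'M[R[i]]_d -> R}.
Hypothesis Nui : is_unitarily_invariant_norm N.
Implicit Types (A B G K L M U V W : 'M[R[i]]_d) (r s g h : 'I_d -> R).

Lemma uinorm_adj A : N (A^t*) = N A.
Proof.
have [U [V [s [uU uV -> _ _]]]] := singular_value_decomposition A.
by rewrite !adjM dgmx_adj mulmxA !(uinormU Nui) ?trmxC_unitary.
Qed.

Lemma sqr_le_of_scaled_mean (x a b : R) : 0 <= a -> 0 <= b ->
  (forall t, 0 < t -> x <= (t * a + b / t) / 2) -> 0 <= x -> x ^+ 2 <= a * b.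
Proof.
move=> a0 b0 H; rewrite le_eqVlt => /predU1P[<-|x0].
  by rewrite expr0n /= mulr_ge0.
move: b0; rewrite le_eqVlt => /predU1P[b0|b0].
  have a1 : 0 < a + 1 by lra.
  (* For [b = 0] a small t suffices: this one gives x <= x a / (2 (a + 1)), impossible for x > 0. *)
  have := H (x / (a + 1)) (divr_gt0 x0 a1).
  rewrite -b0 mul0r addr0 => H1.
  have : x * (a + 1) <= x * a / 2.
    rewrite -ler_pdivlMr //; apply: le_trans H1 _.
    by rewrite le_eqVlt; apply/orP; left; apply/eqP; field; rewrite gt_eqF.
  have := mulr_ge0 (ltW x0) a0; lra.
(* With t = b / x the hypothesis reads x <= (a b / x + x) / 2, which is the claim; no square root
   and no division by [a] is involved. *)
have := H (b / x) (divr_gt0 b0 x0).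
have -> : b / (b / x) = x by field; rewrite !gt_eqF.
move=> H1; have {}H1 : x <= b * a / x.
  by move: H1; rewrite (_ : b / x * a = b * a / x); [lra|field; rewrite gt_eqF].
by move: H1; rewrite ler_pdivlMr // expr2 (mulrC a).
Qed.

(** Entrywise s <= (t g + h / t) / 2 for every t > 0; monotonicity and the triangle inequality carry
    this to norms, and t is then optimised. *)
Lemma uinorm_dgmx_CS s g h : (forall k, 0 <= s k) -> (forall k, 0 <= g k) ->
  (forall k, 0 <= h k) -> (forall k, s k ^+ 2 = g k * h k) ->
  N (dgmx s) ^+ 2 <= N (dgmx g) * N (dgmx h).
Proof.
move=> s0 g0 h0 sgh.
apply: sqr_le_of_scaled_mean; rewrite ?(uinorm_ge0 Nui) // => t t0.
have -> : (t * N (dgmx g) + N (dgmx h) / t) / 2 =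
    (t / 2) * N (dgmx g) + (t^-1 / 2) * N (dgmx h).
  by field; rewrite gt_eqF.
rewrite -!(uinormZ Nui) ?divr_ge0 ?invr_ge0 ?(ltW t0) //.
apply: (le_trans _ (uinormD Nui _ _)); rewrite !dgmxZ dgmxD.
apply: (uinorm_dgmx_le Nui) => k; rewrite s0 /=.
have x0 : 0 <= t / 2 * g k + t^-1 / 2 * h k.
  by rewrite addr_ge0 // mulr_ge0 // divr_ge0 ?invr_ge0 ?(ltW t0).
rewrite -(ler_pXn2r (n := 2)) ?nnegrE ?s0 //.
have -> : (t / 2 * g k + t^-1 / 2 * h k) ^+ 2 =
    (t / 2 * g k - t^-1 / 2 * h k) ^+ 2 + g k * h k.
  by field; rewrite gt_eqF.
by rewrite sgh lerDr sqr_ge0.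
Qed.

(* Writing [M = U s V], pick unitaries E and F making [E G U] and [V K F]
   lower triangular: then the diagonal entries of [E (G M K) F] and of
   [E (G^-* M K^-* ) F] multiply to [s^2] in modulus, so pinching reduces the
   claim to diagonal matrices. *)
Lemma uinorm_CS G K M : G \in unitmx -> K \in unitmx ->
  N M ^+ 2 <= N (G *m M *m K) * N ((invmx G)^t* *m M *m (invmx K)^t*).
Proof.
move=> uG uK.
have [U [V [s [uU uV ME s0 _]]]] := singular_value_decomposition M.
have [uU1 uV1] := (unitarymx_unit uU, unitarymx_unit uV).
(* The inverse of [G *m U] is factored, so that [E *m G *m U] is the inverse of [L1] and hence lower
   triangular too. *)
have [L1 [E [uE trL1 GUE _]]] := lower_unitary_factor (invmx (G *m U)).
have [L2 [F [uF trL2 VKE _]]] := lower_unitary_factor (V *m K).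
set T1 := E *m G *m U.
have L1T1 : L1 *m T1 = 1%:M.
  by rewrite /T1 -mulmxA mulmxA -GUE mulVmx // unitmx_mul uG.
set T2 := F *m invmx K *m V^t*.
have L2T2 : L2 *m T2 = 1%:M.
  rewrite /T2 !mulmxA -VKE -(mulmxA V) mulmxV // mulmx1.
  exact: mulUadj.
have [trT1 LT1] := trig_inv _ _ trL1 L1T1.
have [trT2 LT2] := trig_inv _ _ trL2 L2T2.
have E1 : E *m (G *m M *m K) *m F^t* = T1 *m dgmx s *m L2.
  rewrite ME /T1 -!mulmxA; do 4!congr (_ *m _).
  by rewrite mulmxA VKE -mulmxA mulUadj // mulmx1.
have L1E : L1 = U^t* *m invmx G *m E^t*.
  have -> : U^t* *m invmx G = L1 *m E.
    have uGU : G *m U \in unitmx by rewrite unitmx_mul uG.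
    rewrite -GUE -[LHS](mulmxK uGU) !mulmxA -(mulmxA (U^t*)) mulVmx // mulmx1.
    by rewrite muladjU // mul1mx.
  by rewrite -mulmxA mulUadj // mulmx1.
have E2 : E *m ((invmx G)^t* *m M *m (invmx K)^t*) *m F^t* =
    (T2 *m dgmx s *m L1)^t*.
  rewrite L1E /T2 ME !adjM !trmxCK dgmx_adj !mulmxA; congr (_ *m _ *m _ *m _).
have zE (A B : 'M[R[i]]_d) k : is_trig_mx A -> is_trig_mx B ->
    `|(A *m dgmx s *m B) k k| = `|A k k| * (s k)%:C * `|B k k|.
  move=> tA tB; rewrite trig_mul_diag // !normrM; congr (_ * _ * _).
  by rewrite ger0_norm // lecE /= eqxx s0.
pose a (A : 'M[R[i]]_d) k := complex.Re `|A k k|.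
have aE A k : (a A k)%:C = `|A k k| by rewrite /a normc_def.
have a0 A k : 0 <= a A k.
  by have := normr_ge0 (A k k); rewrite -aE lecE => /andP[].
rewrite -(uinormUl Nui _ (G *m M *m K) uE).
rewrite -(uinormUl Nui _ (_ *m M *m _^t*) uE).
have uF' := adj_unitarymx _ uF.
rewrite -(uinormUr Nui _ (E *m (G *m M *m K)) uF').
rewrite -(uinormUr Nui _ (E *m (_ *m M *m _^t*)) uF') E1 E2 uinorm_adj.
have -> : N M = N (dgmx s) by rewrite ME (uinormU Nui).
have cs : N (dgmx s) ^+ 2 <= N (dgmx (fun k => a T1 k * s k * a L2 k)) *
                  N (dgmx (fun k => a T2 k * s k * a L1 k)).
  apply: uinorm_dgmx_CS => // k; rewrite ?mulr_ge0 //.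
  have aM1 A B : A k k * B k k = 1 -> a A k * a B k = 1.
    move=> AB; apply/complexI; rewrite rmorphM /= !aE -normrM AB.
    exact: normr1.
  have := aM1 _ _ (LT1 k); have := aM1 _ _ (LT2 k) => h2 h1.
  (* Inverse triangular matrices have reciprocal diagonals, so all factors cancel except the squared
     singular value. *)
  have -> : a T1 k * s k * a L2 k * (a T2 k * s k * a L1 k) =
    (a L1 k * a T1 k) * (a L2 k * a T2 k) * s k ^+ 2 by ring.
  by rewrite h1 h2 !mul1r.
apply: le_trans cs _; apply: ler_pM; rewrite ?(uinorm_ge0 Nui) //.
- apply: (uinorm_diag_ge Nui _ (fun k => _)) => // k.
  + by rewrite !mulr_ge0.
  + by rewrite zE // !rmorphM /= !aE.
- apply: (uinorm_diag_ge Nui _ (fun k => _)) => // k.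
  + by rewrite !mulr_ge0.
  + by rewrite zE // !rmorphM /= !aE.
Qed.

End CauchySchwarz.

(** * Scalar power inequalities and Jensen's inequality for powers *)

Section PowerMeans.
Context {R : realType}.
Implicit Types (x y z c theta : R).

Lemma powR_AMGM x y theta : 0 <= x -> 0 <= y -> 0 < theta <= 1 ->
  x `^ theta * y `^ (1 - theta) <= theta * x + (1 - theta) * y.
Proof.
move=> x0 y0 /andP[t0]; rewrite le_eqVlt => /predU1P[->|t1].
  by rewrite subrr powRr0 powRr1 // mulr1 mul1r mul0r addr0.
have t1' : 0 < 1 - theta by rewrite subr_gt0.
have := @conjugate_powR R (x `^ theta) (y `^ (1 - theta)) theta^-1
  (1 - theta)^-1 (powR_ge0 _ _) (powR_ge0 _ _).
rewrite !invr_gt0 !invrK => /(_ t0 t1').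
rewrite addrC subrK => /(_ erefl).
rewrite -!powRrM !divff ?gt_eqF // !powRr1 //.
by rewrite (mulrC x) (mulrC y).
Qed.

(** The tangent line at 1 to the convex function z^(-c). It comes from the weighted AM-GM inequality
    with weight 1 / (1 + c), for which the geometric mean of z^(-c) and z is 1. *)
Lemma powRN_tangent z c : 0 < z -> 0 < c -> 1 + c <= z `^ (- c) + c * z.
Proof.
move=> z0 c0; have c1 : 0 < 1 + c by lra.
have c1' : 1 + c != 0 by rewrite gt_eqF.
have := powR_AMGM (z `^ (- c)) z (1 + c)^-1 (powR_ge0 _ _) (ltW z0).
have -> : 1 - (1 + c)^-1 = c / (1 + c) by field.
rewrite invr_gt0 c1 invf_le1 // lerDl (ltW c0) => /(_ erefl).
rewrite -powRrM -powRD; last by rewrite (gt_eqF z0) implybT.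
have -> : - c * (1 + c)^-1 + c / (1 + c) = 0 by field.
rewrite powRr0.
have -> : (1 + c)^-1 * z `^ (- c) + c / (1 + c) * z =
  (z `^ (- c) + c * z) / (1 + c) by field.
by rewrite ler_pdivlMr // mul1r.
Qed.

Context {I : finType} (w f : I -> R).
Hypotheses (w_ge0 : forall k, 0 <= w k) (w_sum : \sum_k w k = 1).
Hypothesis f_gt0 : forall k, 0 < f k.

Lemma mean_gt0 : 0 < \sum_k f k * w k.
Proof.
have fw0 k : 0 <= f k * w k by rewrite mulr_ge0 // ltW.
rewrite lt_def sumr_ge0 // andbT; apply/eqP => H.
have w0 k : w k = 0.
  have /psumr_eq0P/(_ k isT)/eqP := H.
  rewrite mulf_eq0 gt_eqF //= => H0; apply/eqP/H0 => j _; exact: fw0.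
by move: w_sum; rewrite big1 // => /esym/eqP; rewrite oner_eq0.
Qed.

(** After multiplication by B^(1 - theta), with B the mean, each term is bounded by AM-GM applied to
    [f k] and B. *)
Lemma powR_mean_le theta : 0 < theta <= 1 ->
  \sum_k f k `^ theta * w k <= (\sum_k f k * w k) `^ theta.
Proof.
move=> th; set B := \sum_k f k * w k; have B0 : 0 < B := mean_gt0.
have Bt : 0 < B `^ (1 - theta) by rewrite powR_gt0.
rewrite -(ler_pM2r Bt) -powRD; last by rewrite (gt_eqF B0) implybT.
rewrite (addrC theta) subrK powRr1 ?(ltW B0) // mulr_suml.
rewrite [leRHS](_ : B = \sum_k (theta * f k + (1 - theta) * B) * w k); last first.
  under eq_bigr do rewrite mulrDl -!mulrA.
  by rewrite big_split /= -!mulr_sumr w_sum -/B; ring.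
apply: ler_sum => k _; rewrite mulrAC; apply: ler_wpM2r => //.
by apply: powR_AMGM => //; exact: ltW.
Qed.

(** Average the tangent inequality at the points [f k / A], A being the mean: the linear parts
    average to c and cancel. *)
Lemma powRN_mean_ge c : 0 < c ->
  (\sum_k f k * w k) `^ (- c) <= \sum_k f k `^ (- c) * w k.
Proof.
move=> c0; set A := \sum_k f k * w k; have A0 : 0 < A := mean_gt0.
have : \sum_k (1 + c) * w k <= \sum_k ((f k / A) `^ (- c) + c * (f k / A)) * w k.
  apply: ler_sum => k _; apply: ler_wpM2r => //.
  by apply: powRN_tangent; rewrite // divr_gt0.
rewrite -mulr_sumr w_sum mulr1.
under [in leRHS]eq_bigr do rewrite mulrDl.
rewrite big_split /=.
have -> : \sum_k c * (f k / A) * w k = c.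
  rewrite -[RHS](divfK (x := A)) ?gt_eqF // {3}/A mulr_sumr.
  by apply: eq_bigr => k _; field; rewrite gt_eqF.
rewrite lerD2r.
have -> : \sum_k (f k / A) `^ (- c) * w k =
    A `^ c * \sum_k f k `^ (- c) * w k.
  rewrite mulr_sumr; apply: eq_bigr => k _.
  rewrite powRM ?invr_ge0 ?ltW // -powR_inv1 ?ltW // -powRrM mulN1r opprK.
  by ring.
by rewrite powRN mulrC -ler_pdivrMr ?powR_gt0 // mul1r.
Qed.

End PowerMeans.

(** * Matrix Young inequality for positive diagonals, exponent at least 1/2 *)

Section Young.
Context {R : realType} {d : nat}.
Implicit Types (E L M U V W Z : 'M[R[i]]_d) (a b f g r s w : 'I_d -> R).

Definition sqmod (z : R[i]) : R := complex.Re z ^+ 2 + complex.Im z ^+ 2.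

Lemma sqmod_ge0 z : 0 <= sqmod z.
Proof. by rewrite addr_ge0 ?sqr_ge0. Qed.

Lemma sqmod0 : sqmod 0 = 0.
Proof. by rewrite /sqmod /= expr0n addr0. Qed.

Lemma sqmodE z : (sqmod z)%:C = z * z^*.
Proof. by rewrite add_Re2_Im2 normCK. Qed.

Lemma congr_dgmx_diag Z w k :
  (Z *m dgmx w *m Z^t*) k k = (\sum_j w j * sqmod (Z k j))%:C.
Proof.
rewrite mulmx_adjE rmorph_sum; apply: eq_bigr => j _.
by rewrite mulmx_dgE rmorphM /= sqmodE mulrAC mulrC.
Qed.

(** This makes the squared moduli along a unitary row the probability weights needed for Jensen. *)
Lemma sqmod_unitary_row U k : U \is unitarymx -> \sum_j sqmod (U k j) = 1.
Proof.
move=> uU; apply: complexI; rewrite rmorph_sum /=.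
under eq_bigr do rewrite sqmodE.
by rewrite -mulmx_adjE mulUadj // mxE eqxx.
Qed.

Lemma sqmod_row_dgmx Z r k :
  \sum_j r j ^+ 2 * sqmod (Z k j) = \sum_j sqmod ((Z *m dgmx r) k j).
Proof.
apply: eq_bigr => j _; rewrite mulmx_dgE /sqmod.
by case: (Z k j) => x y /=; ring.
Qed.

Lemma sqmod_row_unitaryr Z U k : U \is unitarymx ->
  \sum_j sqmod ((Z *m U) k j) = \sum_j sqmod (Z k j).
Proof.
move=> uU; apply: complexI; rewrite !rmorph_sum /=.
under eq_bigr do rewrite sqmodE.
under [in RHS]eq_bigr do rewrite sqmodE.
by rewrite -!mulmx_adjE adjM mulmxA -(mulmxA Z) (mulUadj U) // mulmx1.
Qed.

(* E is a Gram-Schmidt basis adapted to the flag spanned by the vectors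
   [b^-1 e_1, ..., b^-1 e_k], where [e_j] are the right singular vectors of
   [a W b] ordered by decreasing singular values. *)
Lemma singular_flag_basis W a b : W \is unitarymx ->
  (forall k, 0 < a k) -> (forall k, 0 < b k) ->
  exists U V s E, [/\ [/\ U \is unitarymx, V \is unitarymx & E \is unitarymx],
    dgmx a *m W *m dgmx b = U *m dgmx s *m V,
    forall k, 0 <= s k &
    forall k, s k ^+ 2 * (\sum_j (a j)^-1 ^+ 2 * sqmod (E k j)) <=
              \sum_j b j ^+ 2 * sqmod ((E *m W) k j)].
Proof.
move=> uW a0 b0.
have dgV (r : 'I_d -> R) : (forall k, r k != 0) ->
    dgmx r *m dgmx (fun k => (r k)^-1) = 1%:M.
  by move=> r0; rewrite dgmxM -dgmx1; apply: eq_dgmx => k; rewrite divff.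
have dgVl (r : 'I_d -> R) : (forall k, r k != 0) ->
    dgmx (fun k => (r k)^-1) *m dgmx r = 1%:M.
  by move=> r0; exact: mulmx1C (dgV _ r0).
have an0 k : a k != 0 by rewrite gt_eqF.
have bn0 k : b k != 0 by rewrite gt_eqF.
have [U [V [s [uU uV ME s0 sle]]]] :=
  singular_value_decomposition (dgmx a *m W *m dgmx b).
have sn0 k : s k != 0.
  have : dgmx s \in unitmx.
    have : dgmx a *m W *m dgmx b \in unitmx.
      rewrite !unitmx_mul (unitarymx_unit uW).
      rewrite (proj1 (mulmx1_unit (dgV _ an0))).
      by rewrite (proj1 (mulmx1_unit (dgV _ bn0))).
    by rewrite ME !unitmx_mul => /andP[/andP[]].
  rewrite unitmxE det_diag unitfE; apply: contraNneq => sk.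
  by apply/eqP; rewrite (bigD1 k) //= mxE sk mul0r.
have [L0 [E [uE trL0 B0E _]]] :=
  lower_unitary_factor (V *m dgmx (fun k => (b k)^-1) *m W^t*).
(* The inverse of [dgmx a *m W *m dgmx b], read off from its singular value decomposition. *)
have B0a : V *m dgmx (fun k => (b k)^-1) *m W^t* *m dgmx (fun k => (a k)^-1) =
    dgmx (fun k => (s k)^-1) *m U^t*.
  have MV : dgmx a *m W *m dgmx b *m (V^t* *m dgmx (fun k => (s k)^-1) *m U^t*) =
      1%:M.
    rewrite ME !mulmxA -(mulmxA _ V) mulUadj // mulmx1 -(mulmxA U) dgV //.
    by rewrite mulmx1 mulUadj.
  rewrite -[LHS]mulmx1 -MV !mulmxA -(mulmxA _ _ (dgmx a)) dgVl // mulmx1.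
  rewrite -(mulmxA _ (W^t*)) muladjU // mulmx1 -(mulmxA _ _ (dgmx b)) dgVl //.
  by rewrite mulmx1 mulUadj // mul1mx.
(* This [L] is the inverse of the triangular factor [L0], hence lower triangular. Both sums of the
   claim are weighted squared lengths of its row k, with weights 1 and s^(-2). *)
have [L LB0 LV] : exists2 L,
    L *m (V *m dgmx (fun k => (b k)^-1) *m W^t*) = E &
    L *m V = E *m W *m dgmx b.
  exists (E *m W *m dgmx b *m V^t*); last by rewrite -mulmxA muladjU // mulmx1.
  rewrite !mulmxA -(mulmxA _ (V^t*)) muladjU // mulmx1.
  by rewrite -(mulmxA _ (dgmx b)) dgV // mulmx1 -(mulmxA E) mulUadj // mulmx1.
have L0L : L0 *m L = 1%:M.
  apply: mulmx1C.
  have -> : L0 = V *m dgmx (fun k => (b k)^-1) *m W^t* *m E^t*.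
    by rewrite B0E -mulmxA mulUadj // mulmx1.
  by rewrite mulmxA LB0 mulUadj.
have [/is_trig_mxP trL _] := trig_inv _ _ trL0 L0L.
exists U, V, s, E; split=> // k.
have -> : \sum_j b j ^+ 2 * sqmod ((E *m W) k j) = \sum_j sqmod (L k j).
  by rewrite sqmod_row_dgmx -LV (sqmod_row_unitaryr L V).
have -> : \sum_j (a j)^-1 ^+ 2 * sqmod (E k j) =
    \sum_j (s j)^-1 ^+ 2 * sqmod (L k j).
  rewrite (sqmod_row_dgmx E) -LB0 -(mulmxA L) B0a mulmxA.
  by rewrite (sqmod_row_unitaryr _ _ _ (adj_unitarymx _ uU)) sqmod_row_dgmx.
(* Only the entries with j <= k survive, and for those [s k <= s j]. *)
rewrite mulr_sumr; apply: ler_sum => j _.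
have [kj|jk] := ltnP k j; first by rewrite trL // sqmod0 !mulr0.
rewrite mulrA -exprMn; apply: ler_piMl; first exact: sqmod_ge0.
have sj0 : 0 < s j by rewrite lt_def sn0 s0.
by rewrite expr_le1 ?divr_ge0 ?(ltW sj0) // ler_pdivrMr // mul1r sle.
Qed.

Context {N : 'M[R[i]]_d -> R}.
Hypothesis Nui : is_unitarily_invariant_norm N.

(* By Jensen's inequality for [x^(-2p)] and for [x^(2(1-p))], concave only when
   [1/2 <= p], the diagonal entries of the arithmetic mean in the basis of
   [singular_flag_basis] dominate the singular values. *)
Lemma uinorm_Young_half (p : R) W f g : W \is unitarymx -> 2^-1 <= p < 1 ->
  (forall k, 0 < f k) -> (forall k, 0 < g k) ->
  N (dgmx (fun k => f k `^ p) *m W *m dgmx (fun k => g k `^ (1 - p))) <=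
  N (dgmx (fun k => p * f k) +
     W *m dgmx (fun k => (1 - p) * g k) *m W^t*).
Proof.
move=> uW /andP[p12 p1] f0 g0.
have p0 : 0 < p by lra.
have q0 : 0 < 1 - p by lra.
have a0 k : 0 < f k `^ p by rewrite powR_gt0.
have b0 k : 0 < g k `^ (1 - p) by rewrite powR_gt0.
have [U [V [s [E [[uU uV uE] -> s0 sE]]]]] := singular_flag_basis _ _ _ uW a0 b0.
have uEW : E *m W \is unitarymx by exact: mul_unitarymx uE uW.
rewrite (uinormU Nui) //.
have uE' := adj_unitarymx _ uE.
rewrite -(uinormU Nui _ _ (_ + _) uE uE').
pose A k := \sum_j f j * sqmod (E k j).
pose B k := \sum_j g j * sqmod ((E *m W) k j).
have dE k : (E *m (dgmx (fun k => p * f k) +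
     W *m dgmx (fun k => (1 - p) * g k) *m W^t*) *m E^t*) k k =
   (p * A k + (1 - p) * B k)%:C.
  rewrite mulmxDr mulmxDl !mulmxA -(mulmxA _ (W^t*)) -adjM mxE.
  rewrite !congr_dgmx_diag -rmorphD; congr _%:C; congr (_ + _).
    by rewrite mulr_sumr; apply: eq_bigr => j _; rewrite mulrA.
  by rewrite mulr_sumr; apply: eq_bigr => j _; rewrite mulrA.
apply: (uinorm_diag_ge Nui _ _ _ dE) => // k.
have wA j : 0 <= sqmod (E k j) by exact: sqmod_ge0.
have wB j : 0 <= sqmod ((E *m W) k j) by exact: sqmod_ge0.
have sA := sqmod_unitary_row _ k uE.
have sB := sqmod_unitary_row _ k uEW.
have A0 : 0 < A k := mean_gt0 _ _ wA sA f0.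
have B0 : 0 < B k := mean_gt0 _ _ wB sB g0.
have sqpow (x e : R) : (x `^ e) ^+ 2 = x `^ (2 * e).
  by rewrite -powR_mulrn ?powR_ge0 // -powRrM mulrC.
have x_le : \sum_j (g j `^ (1 - p)) ^+ 2 * sqmod ((E *m W) k j) <=
    B k `^ (2 * (1 - p)).
  under eq_bigr do rewrite sqpow.
  by apply: (powR_mean_le _ _ wB sB g0); apply/andP; split; lra.
have y_ge : A k `^ (- (2 * p)) <=
    \sum_j (f j `^ p)^-1 ^+ 2 * sqmod (E k j).
  under eq_bigr do rewrite exprVn sqpow -powRN.
  by apply: (powRN_mean_ge _ _ wA sA f0); lra.
(* Hence s <= A^p B^(1 - p) at index k, and AM-GM bounds this by p A + (1 - p) B, the diagonal entry
   [dE]. *)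
have : s k ^+ 2 * A k `^ (- (2 * p)) <= B k `^ (2 * (1 - p)).
  apply: le_trans (le_trans (sE k) x_le).
  by apply: ler_wpM2l => //; exact: sqr_ge0.
rewrite powRN ler_pdivrMr ?powR_gt0 // => sAB.
have m0 : 0 <= p * A k + (1 - p) * B k.
  by apply: addr_ge0; apply: mulr_ge0; exact: ltW.
have -> : `|(p * A k + (1 - p) * B k)%:C| = (p * A k + (1 - p) * B k)%:C.
  by rewrite ger0_norm // lecE /= eqxx.
rewrite lecE /= eqxx /=.
have p01 : 0 < p <= 1 by rewrite p0 ltW.
apply: le_trans (powR_AMGM _ _ _ (ltW A0) (ltW B0) p01).
rewrite -(ler_pXn2r (n := 2)) ?nnegrE ?mulr_ge0 ?powR_ge0 //.
by rewrite exprMn !sqpow mulrC.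
Qed.

End Young.

(** * Passage to nonnegative diagonals and to all exponents in (0, 1) *)

Section Semidefinite.
Context {R : realType} {d : nat} {N : 'M[R[i]]_d -> R}.
Hypothesis Nui : is_unitarily_invariant_norm N.
Implicit Types (W X Y A : 'M[R[i]]_d) (f g r s a b : 'I_d -> R).

Lemma uinorm_dgmxr_le r s A : (forall k, 0 <= r k <= s k) ->
  N (A *m dgmx r) <= N (A *m dgmx s).
Proof.
move=> rs; rewrite -(uinorm_adj Nui) -(uinorm_adj Nui (A *m dgmx s)).
by rewrite !adjM !dgmx_adj (uinorm_dgmxl_le Nui).
Qed.

Lemma uinorm_dgmxlr_le f f' g g' A : (forall k, 0 <= f k <= f' k) ->
  (forall k, 0 <= g k <= g' k) ->
  N (dgmx f *m A *m dgmx g) <= N (dgmx f' *m A *m dgmx g').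
Proof.
move=> ff gg; apply: le_trans (uinorm_dgmxr_le _ _ _ gg) _.
by rewrite -!mulmxA (uinorm_dgmxl_le Nui).
Qed.

Lemma le_of_perturbation (x a b K L : R) :
  0 <= a -> 0 <= b -> 0 <= K -> 0 <= L ->
  (forall e, 0 < e <= 1 -> x <= (a + e * K) * (b + e * L)) -> x <= a * b.
Proof.
move=> a0 b0 K0 L0 H; apply/ler_addgt0Pr => e e0.
have D0 : 0 <= a * L + b * K + K * L by rewrite !addr_ge0 ?mulr_ge0.
set D := _ + _ + _ in D0.
have D1 : 0 < D + 1 by lra.
(* As (a + h K)(b + h L) = a b + h D - h (1 - h) K L, it is enough that h <= 1 and h D <= e; the
   denominator D + 1 is positive even if D = 0. *)
set h := Num.min 1 (e / (D + 1)).
have h0 : 0 < h by rewrite lt_min ltr01 divr_gt0.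
have h1 : h <= 1 by rewrite ge_min lexx.
have hD : h * D <= e.
  have : h * (D + 1) <= e by rewrite -ler_pdivlMr // ge_min lexx orbT.
  by lra.
have /H : 0 < h <= 1 by rewrite h0.
have -> : (a + h * K) * (b + h * L) = a * b + h * D - h * (1 - h) * (K * L).
  by rewrite /D; ring.
have : 0 <= h * (1 - h) * (K * L) by rewrite !mulr_ge0 ?subr_ge0 ?(ltW h0).
by lra.
Qed.

(** Take for G and K in [uinorm_CS] the diagonals sqrt (a1 / a2) and sqrt (b1 / b2): they send the
    geometric means to [a1] and [b1], and their inverses send them to [a2] and [b2]. *)
Lemma uinorm_CS_dgmx_gt0 W a1 a2 b1 b2 :
  (forall k, 0 < a1 k) -> (forall k, 0 < a2 k) ->
  (forall k, 0 < b1 k) -> (forall k, 0 < b2 k) ->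
  N (dgmx (fun k => Num.sqrt (a1 k * a2 k)) *m W *m
     dgmx (fun k => Num.sqrt (b1 k * b2 k))) ^+ 2 <=
  N (dgmx a1 *m W *m dgmx b1) * N (dgmx a2 *m W *m dgmx b2).
Proof.
move=> a10 a20 b10 b20.
pose q (f g : 'I_d -> R) k := Num.sqrt (f k / g k).
have qV (f g : 'I_d -> R) : (forall k, 0 < f k) -> (forall k, 0 < g k) ->
    dgmx (q f g) *m dgmx (q g f) = 1%:M.
  move=> f0 g0; rewrite dgmxM -dgmx1; apply: eq_dgmx => k.
  rewrite /q -sqrtrM ?divr_ge0 ?(ltW (f0 k)) ?(ltW (g0 k)) //.
  by rewrite mulrA divfK ?gt_eqF // divff ?gt_eqF // sqrtr1.
have qU (f g : 'I_d -> R) : (forall k, 0 < f k) -> (forall k, 0 < g k) ->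
    dgmx (q f g) \in unitmx.
  by move=> hf hg; case: (mulmx1_unit (qV _ _ hf hg)).
have qI (f g : 'I_d -> R) : (forall k, 0 < f k) -> (forall k, 0 < g k) ->
    (invmx (dgmx (q f g)))^t* = dgmx (q g f).
  move=> f0 g0; rewrite -[RHS]dgmx_adj; congr (_^t*).
  by rewrite -[LHS]mulmx1 -(qV _ _ f0 g0) mulKmx ?qU.
have qM (f g : 'I_d -> R) k : 0 < f k -> 0 < g k ->
    q f g k * Num.sqrt (f k * g k) = f k.
  move=> f0 g0; rewrite /q -sqrtrM ?divr_ge0 ?ltW //.
  have -> : f k / g k * (f k * g k) = f k ^+ 2 by field; rewrite gt_eqF.
  by rewrite sqrtr_sqr gtr0_norm.
have E (f1 f2 g1 g2 : 'I_d -> R) : (forall k, 0 < f1 k) -> (forall k, 0 < f2 k) ->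
    (forall k, 0 < g1 k) -> (forall k, 0 < g2 k) ->
    dgmx (q f1 f2) *m (dgmx (fun k => Num.sqrt (f1 k * f2 k)) *m W *m
     dgmx (fun k => Num.sqrt (g1 k * g2 k))) *m dgmx (q g1 g2) =
    dgmx f1 *m W *m dgmx g1.
  move=> f10 f20 g10 g20.
  have hf : dgmx (q f1 f2) *m dgmx (fun k => Num.sqrt (f1 k * f2 k)) = dgmx f1.
    by rewrite dgmxM; apply: eq_dgmx => k; exact: qM.
  have hg : dgmx (fun k => Num.sqrt (g1 k * g2 k)) *m dgmx (q g1 g2) = dgmx g1.
    by rewrite dgmxM; apply: eq_dgmx => k; rewrite mulrC qM.
  by rewrite !mulmxA hf -!mulmxA hg.
apply: le_trans (uinorm_CS Nui _ _ _ (qU _ _ a10 a20) (qU _ _ b10 b20)) _.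
rewrite (qI _ _ a10 a20) (qI _ _ b10 b20) (E _ _ _ _ a10 a20 b10 b20).
have sC (f g : 'I_d -> R) : dgmx (fun k => Num.sqrt (f k * g k)) =
    dgmx (fun k => Num.sqrt (g k * f k)).
  by apply: eq_dgmx => k; rewrite mulrC.
by rewrite (sC a1) (sC b1) (E _ _ _ _ a20 a10 b20 b10).
Qed.

(** The term quadratic in e is absorbed by e <= 1, leaving the linear error expected by
    [le_of_perturbation]. *)
Lemma uinorm_perturb W f g e : 0 < e <= 1 ->
  N (dgmx (fun k => f k + e) *m W *m dgmx (fun k => g k + e)) <=
  N (dgmx f *m W *m dgmx g) + e * (N (W *m dgmx g) + N (dgmx f *m W) + N W).
Proof.
move=> /andP[e0 e1].
have pE h : dgmx (fun k => h k + e) = dgmx h + e%:C *: 1%:M.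
  rewrite -dgmx1 dgmxZ dgmxD; apply: eq_dgmx => k; by rewrite mulr1.
have -> : dgmx (fun k => f k + e) *m W *m dgmx (fun k => g k + e) =
    dgmx f *m W *m dgmx g +
    e%:C *: (W *m dgmx g + dgmx f *m W + e%:C *: W).
  rewrite !pE !mulmxDl !mulmxDr -!scalemxAl -!scalemxAr !mul1mx !mulmx1.
  by rewrite !scalerDr -addrA; congr (_ + _); rewrite addrCA addrA.
apply: le_trans (uinormD Nui _ _) _; rewrite lerD2l (uinormZ Nui) ?(ltW e0) //.
rewrite ler_pM2l //; apply: le_trans (uinormD Nui _ _) _.
apply: lerD; first exact: uinormD.
by rewrite (uinormZ Nui) ?(ltW e0) // ler_piMl // (uinorm_ge0 Nui).
Qed.

Lemma uinorm_CS_dgmx W a1 a2 b1 b2 :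
  (forall k, 0 <= a1 k) -> (forall k, 0 <= a2 k) ->
  (forall k, 0 <= b1 k) -> (forall k, 0 <= b2 k) ->
  N (dgmx (fun k => Num.sqrt (a1 k * a2 k)) *m W *m
     dgmx (fun k => Num.sqrt (b1 k * b2 k))) ^+ 2 <=
  N (dgmx a1 *m W *m dgmx b1) * N (dgmx a2 *m W *m dgmx b2).
Proof.
move=> a10 a20 b10 b20; have N0 := uinorm_ge0 Nui.
apply: (le_of_perturbation _ _ _
  (N (W *m dgmx b1) + N (dgmx a1 *m W) + N W)
  (N (W *m dgmx b2) + N (dgmx a2 *m W) + N W)); rewrite ?addr_ge0 ?N0 //.
move=> e e01; have /andP[e0 _] := e01.
have pos (f : 'I_d -> R) : (forall k, 0 <= f k) -> forall k, 0 < f k + e.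
  by move=> f0 k; rewrite ltr_wpDl.
have mono (f g : 'I_d -> R) : (forall k, 0 <= f k) -> (forall k, 0 <= g k) ->
    forall k, 0 <= Num.sqrt (f k * g k) <= Num.sqrt ((f k + e) * (g k + e)).
  move=> f0 g0 k; rewrite sqrtr_ge0 ler_sqrt; last first.
    by rewrite mulr_ge0 // ltW ?pos.
  by apply: ler_pM; rewrite ?lerDl ?f0 ?g0 ?(ltW e0).
apply: (@le_trans _ _ (N (dgmx (fun k => Num.sqrt ((a1 k + e) * (a2 k + e))) *m W *m
     dgmx (fun k => Num.sqrt ((b1 k + e) * (b2 k + e)))) ^+ 2)).
  rewrite ler_pXn2r ?nnegrE ?N0 //.
  by apply: uinorm_dgmxlr_le; exact: mono.
apply: le_trans (uinorm_CS_dgmx_gt0 _ _ _ _ _ (pos _ a10) (pos _ a20)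
  (pos _ b10) (pos _ b20)) _.
by apply: ler_pM; rewrite ?N0 // uinorm_perturb.
Qed.

Lemma uinorm_Young (p : R) W f g : W \is unitarymx -> 0 < p < 1 ->
  (forall k, 0 <= f k) -> (forall k, 0 <= g k) ->
  N (dgmx (fun k => f k `^ p) *m W *m dgmx (fun k => g k `^ (1 - p))) <=
  N (dgmx (fun k => p * f k) + W *m dgmx (fun k => (1 - p) * g k) *m W^t*).
Proof.
move=> uW /andP[p0 p1]; have uW' := adj_unitarymx _ uW.
move: f g; suff pos f g : (forall k, 0 < f k) -> (forall k, 0 < g k) ->
  N (dgmx (fun k => f k `^ p) *m W *m dgmx (fun k => g k `^ (1 - p))) <=
  N (dgmx (fun k => p * f k) + W *m dgmx (fun k => (1 - p) * g k) *m W^t*).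
  move=> f g f0 g0; apply/ler_addgt0Pr => e e0.
  have N1 : 0 < N 1%:M + 1 by have := uinorm_ge0 Nui 1%:M; lra.
  (* Shifting f and g by h adds p h + (1 - p) h = h times the identity on the right, which costs at
     most e in norm. *)
  pose h := e / (N 1%:M + 1); have h0 : 0 < h by rewrite divr_gt0.
  apply: (@le_trans _ _ (N (dgmx (fun k => (f k + h) `^ p) *m W *m
      dgmx (fun k => (g k + h) `^ (1 - p))))).
    apply: uinorm_dgmxlr_le => k; rewrite powR_ge0 /=.
      by apply: ge0_ler_powR; rewrite ?nnegrE ?addr_ge0 ?lerDl ?(ltW h0) ?(ltW p0).
    have q0 : 0 <= 1 - p by lra.
    by apply: (ge0_ler_powR q0); rewrite ?nnegrE ?addr_ge0 ?lerDl ?(ltW h0).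
  apply: le_trans (pos _ _ _ _) _ => [k|k|]; [by rewrite ltr_wpDl..|].
  have pE (c : R) (u : 'I_d -> R) :
      dgmx (fun k => c * (u k + h)) = dgmx (fun k => c * u k) + (c * h)%:C *: 1%:M.
    by rewrite -dgmx1 dgmxZ dgmxD; apply: eq_dgmx => k; rewrite mulr1 mulrDr.
  have -> : dgmx (fun k => p * (f k + h)) +
      W *m dgmx (fun k => (1 - p) * (g k + h)) *m W^t* =
    dgmx (fun k => p * f k) + W *m dgmx (fun k => (1 - p) * g k) *m W^t* +
    h%:C *: 1%:M.
    rewrite !pE mulmxDr mulmxDl -scalemxAr -scalemxAl mulmx1 mulUadj //.
    rewrite addrACA -scalerDl; congr (_ + _ *: _).
    by rewrite -rmorphD; congr _%:C; ring.
  apply: le_trans (uinormD Nui _ _) _; rewrite lerD2l (uinormZ Nui) ?(ltW h0) //.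
  by rewrite /h mulrAC ler_pdivrMr // ler_pM2l // lerDl.
move=> f0 g0; have [p12|p12] := lerP (2^-1) p.
  by apply: (uinorm_Young_half Nui); rewrite // p12.
have h1p : 2^-1 <= 1 - p < 1 by apply/andP; split; lra.
(* For p < 1/2, exchange f with g, p with 1 - p and W with its adjoint; taking the adjoint on the
   left and conjugating by W on the right restores the claim. *)
have := uinorm_Young_half Nui (1 - p) _ g f uW' h1p g0 f0.
have -> : 1 - (1 - p) = p by ring.
rewrite -(uinorm_adj Nui) !adjM !dgmx_adj trmxCK mulmxA => H.
apply: le_trans H _.
rewrite -(uinormU Nui _ _ (dgmx (fun k => (1 - p) * g k) + _) uW uW').
rewrite mulmxDr mulmxDl !mulmxA.
rewrite (mulUadj W) // mul1mx -(mulmxA _ W (W^t*)) (mulUadj W) // mulmx1.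
by rewrite addrC.
Qed.

End Semidefinite.

(** * Behaviour of q x^(r/q) as q tends to 0 from above *)

Lemma powR_perspective_unbounded {R : realType} (z : R) : 1 < z ->
  ~ cvg (q * z `^ q^-1 @[q --> 0^'+]).
Proof.
move=> z1 cz; set l := lim (q * z `^ q^-1 @[q --> 0^'+]) in cz.
have lnz : 0 < ln z by rewrite ln_gt0.
suff : \forall q \near (0 : R)^'+, False by move/filter_ex => [].
near=> q.
have q0 : 0 < q by near: q; exact: nbhs_right_gt.
have l1 : 0 < `|l| + 1 by rewrite ltr_wpDl.
have qz : q * z `^ q^-1 < `|l| + 1.
  near: q; apply: (cvgr_lt l) => //.
  by apply: le_lt_trans (ler_norm _) _; rewrite ltrDl.
(* Since exp u >= 1 + u^2 / 2 at u = ln z / q, the quantity q z^(1/q) is at least (ln z)^2 / (2 q),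
   which for such q exceeds the bound [qz]. *)
have ql : q < ln z ^+ 2 / 2 / (`|l| + 1).
  by near: q; apply: nbhs_right_lt; rewrite !divr_gt0 // exprn_gt0.
have zE : 1 + (q^-1 * ln z) ^+ 2 / 2 <= z `^ q^-1.
  rewrite /powR gt_eqF ?(lt_trans _ z1) //.
  apply: le_trans (expR_ge1Dxn 1 _) => //.
  by rewrite mulr_ge0 ?invr_ge0 ?ltW.
have : ln z ^+ 2 / 2 < (`|l| + 1) * q.
  have -> : ln z ^+ 2 / 2 = q * (q * ((q^-1 * ln z) ^+ 2 / 2)).
    by field; rewrite gt_eqF.
  rewrite mulrC ltr_pM2r //; apply: le_lt_trans qz.
  rewrite ler_pM2l //; apply: le_trans zE; by rewrite lerDr.
by rewrite ltNge mulrC -ler_pdivlMr // (ltW ql).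
Unshelve. all: by end_near. Qed.

(** With z = x^r the function is q z^(1/q). Convergence excludes z > 1, and for z <= 1 the values
    are squeezed between 0 and q. *)
Lemma powR_perspective_lim {R : realType} (x r : R) : 0 <= x ->
  cvg (q * x `^ (r / q) @[q --> 0^'+]) ->
  x `^ r <= 1 /\ lim (q * x `^ (r / q) @[q --> 0^'+]) = 0.
Proof.
move=> x0; under eq_fun do rewrite powRrM.
set z := x `^ r => cz; have z0 : 0 <= z by exact: powR_ge0.
have z1 : z <= 1 by rewrite leNgt; apply/negP => /powR_perspective_unbounded.
split=> //; apply/cvg_lim => //.
apply: (@squeeze_cvgr _ _ _ _ (cst 0) id); last 2 first.
- exact: cvg_cst.
- exact: cvg_at_right_filter cvg_id.
near=> q; have q0 : 0 < q by near: q; exact: nbhs_right_gt.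
rewrite /= mulr_ge0 ?powR_ge0 ?(ltW q0) //= ler_piMr ?(ltW q0) //.
move: z0; rewrite le_eqVlt => /predU1P[<-|zp].
  by rewrite powR0 ?invr_eq0 ?gt_eqF.
by rewrite -(powRr0 z) ger_powR ?zp // invr_ge0 ltW.
Unshelve. all: by end_near. Qed.

(** * Young's inequality for weighted powers, endpoints included *)

Section WeightedPowers.
Context {R : realType} {d : nat} {N : 'M[R[i]]_d -> R}.
Hypothesis Nui : is_unitarily_invariant_norm N.
Implicit Types (X Y A B : 'M[R[i]]_d).

Lemma hermfunE (f : R -> R) X :
  hermfun f X = (spectralmx X)^t* *m dgmx (fun k => f (eigval X k)) *m
    spectralmx X.
Proof. by rewrite /hermfun invmx_unitary ?spectral_unitarymx. Qed.

Lemma weighted_powE w r X : w != 0 -> weighted_pow w r X =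
  (spectralmx X)^t* *m dgmx (fun k => w * eigval X k `^ (r / w)) *m spectralmx X.
Proof.
move=> /negPf w0; rewrite /weighted_pow w0 /mxpow hermfunE -dgmxZ.
by rewrite -scalemxAr -scalemxAl.
Qed.

(** At weight 0 the term disappears, but the power [r] of X is then a contraction, which replaces
    Young's inequality at the endpoints. *)
Lemma weighted_pow0 r X : (forall k, 0 <= eigval X k) ->
  weighted_pow_defined 0 r X ->
  weighted_pow 0 r X = 0 /\ forall k, eigval X k `^ r <= 1.
Proof.
move=> x0 /(_ erefl) cx; rewrite /weighted_pow eqxx.
have xl k := powR_perspective_lim _ _ (x0 k) (cx k).
split=> [|k]; last by case: (xl k).
rewrite hermfunE -[RHS](mul0mx _ (spectralmx X)); congr (_ *m _).
rewrite -[RHS](mulmx0 _ ((spectralmx X)^t*)); congr (_ *m _).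
apply/matrixP => j k; rewrite dgmxE mxE; have [_ ->] := xl j.
by rewrite mul0rn.
Qed.

(** [uinorm_Young] for the unitary [P *m Q^t*] between the two eigenbases, its right-hand side
    conjugated back by P. *)
Lemma uinorm_Young_conj (w r u : R) (P Q : 'M[R[i]]_d) (x y : 'I_d -> R) :
  P \is unitarymx -> Q \is unitarymx -> 0 < w < 1 ->
  N (dgmx (fun k => x k `^ r) *m (P *m Q^t*) *m dgmx (fun k => y k `^ u)) <=
  N (P^t* *m dgmx (fun k => w * x k `^ (r / w)) *m P +
     Q^t* *m dgmx (fun k => (1 - w) * y k `^ (u / (1 - w))) *m Q).
Proof.
move=> uP uQ w01; have /andP[w0 w1] := w01.
have uP' := adj_unitarymx _ uP.
have uQ' := adj_unitarymx _ uQ.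
have uW := mul_unitarymx uP uQ'.
have f0 k : 0 <= x k `^ (r / w) by exact: powR_ge0.
have g0 k : 0 <= y k `^ (u / (1 - w)) by exact: powR_ge0.
have [wn0 w'n0] : w != 0 /\ 1 - w != 0.
  by split; rewrite gt_eqF // subr_gt0.
apply: le_trans (le_trans _ (uinorm_Young Nui _ _ _ _ uW w01 f0 g0)) _.
  rewrite le_eqVlt; apply/orP; left; apply/eqP; congr (N (_ *m _ *m _)).
    by apply: eq_dgmx => k; rewrite -powRrM divfK.
  by apply: eq_dgmx => k; rewrite -powRrM divfK.
rewrite -(uinormU Nui _ _ (P^t* *m _ *m P + _) uP uP').
rewrite mulmxDr mulmxDl adjM trmxCK !mulmxA (mulUadj _ uP) mul1mx.
by rewrite -(mulmxA _ P (P^t*)) (mulUadj _ uP) mulmx1.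
Qed.

Lemma uinorm_weighted_Young (w r u : R) X Y :
  (forall k, 0 <= eigval X k) -> (forall k, 0 <= eigval Y k) -> 0 <= w <= 1 ->
  weighted_pow_defined w r X -> weighted_pow_defined (1 - w) u Y ->
  N (dgmx (fun k => eigval X k `^ r) *m (spectralmx X *m (spectralmx Y)^t*) *m
     dgmx (fun k => eigval Y k `^ u)) <=
  N (weighted_pow w r X + weighted_pow (1 - w) u Y).
Proof.
move=> x0 y0 /andP[w0 w1] dX dY.
have uP : spectralmx X \is unitarymx by exact: spectral_unitarymx.
have uQ : spectralmx Y \is unitarymx by exact: spectral_unitarymx.
have uP' := adj_unitarymx _ uP.
have uQ' := adj_unitarymx _ uQ.
have uW := mul_unitarymx uP uQ'.
have [w00|wn0] := eqVneq w 0.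
  move: dX dY; rewrite w00 subr0 => /(weighted_pow0 _ _ x0)[-> x1] _.
  rewrite add0r (weighted_powE _ _ _ (oner_neq0 _)) (uinormU Nui _ _ _ uQ' uQ).
  apply: (@le_trans _ _ (N (spectralmx X *m (spectralmx Y)^t* *m
     dgmx (fun k => eigval Y k `^ u)))).
    rewrite -mulmxA (uinorm_contract Nui) // => k; by rewrite powR_ge0 x1.
  rewrite (uinormUl Nui _ _ uW) le_eqVlt; apply/orP; left; apply/eqP; congr N.
  by apply: eq_dgmx => k; rewrite mul1r divr1.
have [w11|wn1] := eqVneq w 1.
  move: dX dY; rewrite w11 subrr => _ /(weighted_pow0 _ _ y0)[-> y1].
  rewrite addr0 (weighted_powE _ _ _ (oner_neq0 _)) (uinormU Nui _ _ _ uP' uP).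
  apply: (@le_trans _ _ (N (dgmx (fun k => eigval X k `^ r) *m
     (spectralmx X *m (spectralmx Y)^t*) *m dgmx (fun=> 1)))).
    by apply: (uinorm_dgmxr_le Nui) => k; rewrite powR_ge0 y1.
  rewrite dgmx1 mulmx1 (uinormUr Nui _ _ uW) le_eqVlt; apply/orP; left; apply/eqP.
  by congr N; apply: eq_dgmx => k; rewrite mul1r divr1.
have w'n0 : 1 - w != 0 by rewrite subr_eq0 eq_sym.
have w01 : 0 < w < 1 by rewrite !lt_def wn0 w0 eq_sym wn1 w1.
rewrite (weighted_powE _ _ _ wn0) (weighted_powE _ _ _ w'n0).
exact: uinorm_Young_conj uP uQ w01.
Qed.

Lemma powR_split (x m n : R) : 0 <= x -> m + n = 1 -> x = x `^ m * x `^ n.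
Proof.
move=> x0 mn; have [->|xn0] := eqVneq x 0; last first.
  by rewrite -powRD ?xn0 ?implybT // mn powRr1.
(* At x = 0 the convention 0^0 = 1 does no harm: m and n are not both 0, so one factor vanishes. *)
have [m0|m0] := eqVneq m 0; last by rewrite powR0 // mul0r.
by rewrite (_ : n = 1) ?powRr1 ?mulr0 // -mn m0 add0r.
Qed.

(** Insert the polar forms of [A] and [B]; the outer unitaries leave the norm unchanged. *)
Lemma uinorm_mul_adj A B (X := A^t* *m A) (Y := B^t* *m B) :
  N (A *m B^t*) = N (dgmx (fun k => Num.sqrt (eigval X k)) *m
    (spectralmx X *m (spectralmx Y)^t*) *m
    dgmx (fun k => Num.sqrt (eigval Y k))).
Proof.
have [_ [U uU AE]] := gram_factor A; have [_ [V uV BE]] := gram_factor B.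
have uV' := adj_unitarymx _ uV.
rewrite -/X in AE; rewrite -/Y in BE.
rewrite -[RHS](uinormU Nui _ _ _ uU uV') {1}AE {1}BE.
by rewrite !adjM dgmx_adj !mulmxA.
Qed.

End WeightedPowers.

(** * The norm inequality for general matrices *)

Theorem corollary3p3 (R : realType) (d : nat) (A B : 'M[R[i]]_d)
    (m n s t p : R) (N : 'M[R[i]]_d -> R) :
  m + n = 1 -> s + t = 1 ->
  is_unitarily_invariant_norm N ->
  0 <= p <= 1 ->
  (* these four conditions are void when 0 < p < 1 *)
  weighted_pow_defined p m (A ^t* *m A) ->
  weighted_pow_defined (1 - p) s (B ^t* *m B) ->
  weighted_pow_defined (1 - p) n (A ^t* *m A) ->
  weighted_pow_defined p t (B ^t* *m B) ->
  (N (A *m B ^t*)) ^+ 2 <=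
    N (weighted_pow p m (A ^t* *m A) + weighted_pow (1 - p) s (B ^t* *m B)) *
    N (weighted_pow (1 - p) n (A ^t* *m A) + weighted_pow p t (B ^t* *m B)).
Proof.
move=> mn st Nui p01 dXm dYs dXn dYt.
have [x0 _] := gram_factor A; have [y0 _] := gram_factor B.
rewrite (uinorm_mul_adj Nui).
set X := A^t* *m A; set Y := B^t* *m B.
rewrite -/X in x0 dXm dXn *; rewrite -/Y in y0 dYs dYt *.
have -> : dgmx (fun k => Num.sqrt (eigval X k)) =
    dgmx (fun k => Num.sqrt (eigval X k `^ m * eigval X k `^ n)).
  by apply: eq_dgmx => k; rewrite -powR_split.
have -> : dgmx (fun k => Num.sqrt (eigval Y k)) =
    dgmx (fun k => Num.sqrt (eigval Y k `^ s * eigval Y k `^ t)).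
  by apply: eq_dgmx => k; rewrite -powR_split.
(* Cauchy-Schwarz pairs the exponents m with s and n with t. *)
apply: le_trans (uinorm_CS_dgmx Nui _ _ _ _ _ _ _ _ _) _;
  try by move=> k; exact: powR_ge0.
have pE : 1 - (1 - p) = p by ring.
have p01' : 0 <= 1 - p <= 1 by case/andP: p01 => *; apply/andP; split; lra.
apply: ler_pM; rewrite ?(uinorm_ge0 Nui) //.
  exact: (uinorm_weighted_Young Nui).
(* The second factor uses weight 1 - p on X, so its complement on Y is p. *)
have := uinorm_weighted_Young Nui (1 - p) n t X Y x0 y0 p01' dXn.
by rewrite pE; apply.
Qed.
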